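(* Let $d=d_\delta$ be a rotation-invariant distance on $\mathcal{S}^{q-1}$, $d_\delta(\theta,\psi)=\delta(\theta'\psi)$, based on a monotone strictly decreasing function $\delta:[-1,1]\to\mathbb{R}^+$. Assume that the distribution $H$ on $\mathcal{S}^{q-1}$ admits a density of the form $x\mapsto c_{q,h}\,h(x'\theta_0)$ for some $\theta_0\in\mathcal{S}^{q-1}$ and some monotone strictly increasing function $h:[-1,1]\to\mathbb{R}^+$, where $c_{q,h}$ is a normalizing constant. Then $\theta\mapsto D_{d_\delta}(\theta,H)$ is a monotone strictly increasing function of $\theta'\theta_0$, so that $\theta\mapsto D_{d_\delta}(\theta,H)$ is uniquely maximized over $\mathcal{S}^{q-1}$ at $\theta_0$.
   Context: Let $q\ge 2$ and $\mathcal{S}^{q-1}=\{x\in\mathbb{R}^q: x'x=1\}$, where $'$ denotes transpose; $\mathbb{R}^+=[0,\infty)$. Densities on $\mathcal{S}^{q-1}$ are with respect to the surface area measure. A distance $d$ on $\mathcal{S}^{q-1}$ is a metric on this set; it is rotation-invariant if $d(O\theta,O\psi)=d(\theta,\psi)$ for all $\theta,\psi\in\mathcal{S}^{q-1}$ and all $q\times q$ orthogonal matrices $O$; any such distance is of the form $d_\delta(\theta,\psi)=\delta(\theta'\psi)$ for some $\delta:[-1,1]\to\mathbb{R}^+$. For a bounded distance $d$ put $d^{\rm sup}=\sup\{d(\theta,\psi):\theta,\psi\in\mathcal{S}^{q-1}\}$. For a (Borel probability) distribution $H$ on $\mathcal{S}^{q-1}$, the directional $d$-depth of $\theta\in\mathcal{S}^{q-1}$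 with respect to $H$ is $D_d(\theta,H)=d^{\rm sup}-E_H[d(\theta,W)]$, where $E_H$ is expectation when $W$ has distribution $H$. *)

(* Defs.v *)
From HB Require Import structures.
From mathcomp Require Import all_boot all_order all_algebra.
From mathcomp Require Import all_classical all_reals all_analysis.
From mathcomp Require Import measurable_realfun lra.

Set Implicit Arguments.
Unset Strict Implicit.
Unset Printing Implicit Defensive.

Import Order.TTheory GRing.Theory Num.Theory.
Import numFieldNormedType.Exports.

Local Open Scope classical_set_scope.
Local Open Scope ring_scope.

Section tuple_power.
Local Open Scope ereal_scope.
Context d (T : measurableType d) (R : realType).

Definition cons_pair k (p : T * k.-tuple T) : k.+1.-tuple T :=
  [tuple of p.1 :: p.2].

Lemma measurable_cons_pair k :
  measurable_fun [set: T * k.-tuple T] (@cons_pair k).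
Proof. exact: (measurable_cons measurable_fst measurable_snd). Qed.

Variable mu : {sigma_finite_measure set T -> \bar R}.

Section step.
Variables (k : nat) (nu : {sigma_finite_measure set (k.-tuple T) -> \bar R}).

(* Product of mu and nu, carried over to (k+1)-tuples. *)
Definition tuple_step : set (k.+1.-tuple T) -> \bar R :=
  pushforward (mu \x nu) (@cons_pair k).

Let mf := @measurable_cons_pair k.

Let tuple_step0 : tuple_step set0 = 0.
Proof. by rewrite /tuple_step /pushforward preimage_set0 measure0. Qed.

Let tuple_step_ge0 A : 0 <= tuple_step A.
Proof. exact: measure_ge0. Qed.

Let tuple_step_sigma_additive : semi_sigma_additive tuple_step.
Proof.
move=> F mF tF mUF; rewrite /tuple_step /pushforward preimage_bigcup.
apply: measure_semi_sigma_additive.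
- by move=> n; rewrite -[X in measurable X]setTI; exact: mf.
- apply/trivIsetP => /= i j _ _ ij; rewrite -preimage_setI.
  by move/trivIsetP : tF => /(_ _ _ _ _ ij) ->//; rewrite preimage_set0.
- by rewrite -preimage_bigcup -[X in measurable X]setTI; exact: mf.
Qed.

HB.instance Definition _ := isMeasure.Build _ _ _ tuple_step
  tuple_step0 tuple_step_ge0 tuple_step_sigma_additive.

Let tuple_step_sigma_finite : sigma_finite setT tuple_step.
Proof.
have /sigma_finiteP[F [TF ndF Foo]] := sigma_finiteT mu.
have /sigma_finiteP[G [TG ndG Goo]] := sigma_finiteT nu.
pose u (t : k.+1.-tuple T) : T * k.-tuple T := (thead t, [tuple of behead t]).
have mu_ : measurable_fun [set: k.+1.-tuple T] u.
  apply/measurable_fun_pair; last exact: measurable_behead.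
  exact: measurable_tnth.
have uK t : cons_pair (u t) = t by rewrite /cons_pair /u /= -tuple_eta.
have consK p : u (cons_pair p) = p.
  by case: p => x t; rewrite /u /cons_pair /thead tnth0 /=; congr pair;
    exact/val_inj.
exists (fun i => u @^-1` (F i `*` G i)).
  rewrite predeqE => t; split => // _.
  have [i _ Fi] : (\bigcup_i F i) (u t).1 by rewrite -TF.
  have [j _ Gj] : (\bigcup_i G i) (u t).2 by rewrite -TG.
  exists (maxn i j) => //; split.
    by move: (u t).1 Fi; exact/subsetPset/ndF/leq_maxl.
  by move: (u t).2 Gj; exact/subsetPset/ndG/leq_maxr.
move=> i; have [? ?] := Foo i; have [? ?] := Goo i; split.
  by rewrite -[X in measurable X]setTI; apply: mu_ => //; exact: measurableX.
rewrite /tuple_step /pushforward -comp_preimage.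
rewrite (_ : u \o @cons_pair k = id); last exact/funext.
by rewrite preimage_id product_measure1E// lte_mul_pinfty// ge0_fin_numE.
Qed.

HB.instance Definition _ := Measure_isSigmaFinite.Build _ _ _ tuple_step
  tuple_step_sigma_finite.

End step.

Fixpoint tuple_power k : {sigma_finite_measure set (k.-tuple T) -> \bar R} :=
  if k is k'.+1 then tuple_step (tuple_power k')
  else @dirac _ _ ([tuple] : 0.-tuple T) R.

End tuple_power.

(* Lebesgue measure on R^k, as the k-fold product of one-dimensional Lebesgue
   measure. *)
Definition lebesgue_tuple (R : realType) k :
    {sigma_finite_measure set (k.-tuple (measurableTypeR R)) -> \bar R} :=
  tuple_power (@lebesgue_measure R) k.

Definition tuple_col (R : realType) k (t : k.-tuple (measurableTypeR R)) :
  'cV[R]_k := \col_i tnth t i.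

Definition dotv (R : realType) k (x y : 'cV[R]_k) : R := (x^T *m y) 0 0.

(* The unit sphere S^n of R^(n+1). Writing the ambient dimension q as n.+1
   keeps the sphere inhabited, as the library demands of a measurable space. *)
Definition unit_sphere (R : realType) n : set 'cV[R]_n.+1 :=
  [set x | dotv x x = 1].

Definition sphere (R : realType) n : Type := set_type (@unit_sphere R n).

Definition sphere_val (R : realType) n (x : sphere R n) : 'cV[R]_n.+1 :=
  set_val x.
Coercion sphere_val : sphere >-> matrix.

Lemma dotvE (R : realType) k (x y : 'cV[R]_k) :
  dotv x y = \sum_i x i 0 * y i 0.
Proof. by rewrite /dotv mxE; apply: eq_bigr => i _; rewrite mxE. Qed.

Lemma unit_sphere_delta (R : realType) n :
  @unit_sphere R n (delta_mx ord0 0).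
Proof.
rewrite /unit_sphere/= dotvE (bigD1 ord0)//= mxE eqxx mulr1 big1 ?addr0//.
by move=> i i0; rewrite mxE (negbTE i0) mul0r.
Qed.

HB.instance Definition _ (R : realType) n :=
  Topological.copy (sphere R n) (set_type (@unit_sphere R n)).
HB.instance Definition _ (R : realType) n := isPointed.Build (sphere R n)
  (SigSub (mem_set (unit_sphere_delta R n))).

Definition sphere_display : measure_display.
Proof. exact. Qed.

HB.instance Definition _ (R : realType) n :=
  @isMeasurable.Build sphere_display (sphere R n) <<s @open (sphere R n) >>
    (@sigma_algebra0 _ setT _) (@sigma_algebraC _ _)
    (@sigma_algebra_bigcup _ setT _).

Section surface_area.
Context (R : realType) (n : nat).

Definition cone (A : set (sphere R n)) :
    set (n.+1.-tuple (measurableTypeR R)) :=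
  [set t | exists r (x : sphere R n),
    [/\ 0 < r, r <= 1, A x & tuple_col t = r *: sphere_val x]].

Lemma measurable_preimage_open d (T : measurableType d) k
    (f : T -> 'cV[R]_k) (U : set 'cV[R]_k) :
  (forall i, measurable_fun [set: T] (fun t => f t i 0 : R)) -> open U ->
  measurable (f @^-1` U).
Proof.
move=> mf oU.
pose box (p : 'cV[rat]_k * nat) : set 'cV[R]_k :=
  [set y | forall i, y i 0 \in
     `]ratr (p.1 i 0) - p.2.+1%:R^-1, ratr (p.1 i 0) + p.2.+1%:R^-1[].
have -> : U = \bigcup_(p in [set p | box p `<=` U]) box p.
  rewrite eqEsubset; split; last by move=> x [p /= pU px]; exact: pU.
  move=> x Ux.
  have /nbhs_ballP[e /= e0 eU] : nbhs x U by exact: open_nbhs_nbhs.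
  have [m me] : exists m : nat, m.+1%:R^-1 < e / 2.
    have [m _ H] := near_infty_natSinv_lt (PosNum (divr_gt0 e0 (ltr0n R 2))).
    by exists m; apply: H => /=.
  have m0 : (0 : R) < m.+1%:R^-1 by rewrite invr_gt0 ltr0n.
  have /choice[c cP] (i : 'I_k) : exists c : rat,
      ratr c \in `]x i 0 - m.+1%:R^-1, x i 0 + m.+1%:R^-1[.
    by apply: rat_in_itvoo; rewrite ltrBlDr -addrA ltrDl addr_gt0.
  exists (\col_i c i, m) => /=.
    move=> y yP; apply: eU; split => // i j; rewrite (ord1 j).
    have := yP i; have := cP i; rewrite !mxE !in_itv/= => /andP[c1 c2] /andP[y1 y2].
    rewrite /ball/= ltr_norml.
    move: c1 c2 y1 y2 me; move: m.+1%:R^-1 (ratr (c i)) (x i 0) (y i 0).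
    by move=> w cc a b *; apply/andP; split; lra.
  move=> i; have := cP i; rewrite !mxE !in_itv/= => /andP[].
  by move: m.+1%:R^-1 (ratr (c i)) (x i 0) => w cc a *; apply/andP; split; lra.
rewrite preimage_bigcup bigcup_mkcond; apply: countable_bigcupT_measurable.
  exact: countableP.
move=> p; case: ifP => // _.
have -> : f @^-1` box p = \bigcap_i ((fun t => f t i 0) @^-1`
    `]ratr (p.1 i 0) - p.2.+1%:R^-1, ratr (p.1 i 0) + p.2.+1%:R^-1[%classic).
  by rewrite eqEsubset; split => t /= + i => /(_ i); exact.
apply: fin_bigcap_measurable => //= i _.
by rewrite -[X in measurable X]setTI; apply: mf => //; exact: measurable_itv.
Qed.

Lemma cone_val (B : set 'cV[R]_n.+1) :
  let s t := dotv (tuple_col t) (tuple_col t) in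
  cone (@sphere_val R n @^-1` B) =
  [set t | 0 < s t <= 1] `&`
    (fun t => (s t `^ 2^-1)^-1 *: tuple_col t) @^-1` B.
Proof.
move=> s; have sE t r (x : sphere R n) :
    tuple_col t = r *: sphere_val x -> s t = r ^+ 2.
  move=> e; rewrite /s e dotvE.
  under eq_bigr do rewrite !mxE mulrACA.
  by rewrite -mulr_sumr -dotvE (set_valP x) mulr1.
rewrite eqEsubset; split => t /=.
  move=> [r [x [r0 r1 Bx e]]]; have st := sE _ _ _ e.
  rewrite st (exprn_gt0 _ r0) (exprn_ile1 _ (ltW r0) r1); split => //.
  rewrite powR12_sqrt ?sqr_ge0// sqrtr_sqr gtr0_norm// e scalerA mulVf ?gt_eqF//.
  by rewrite scale1r.
move=> [/andP[s0 s1] Bt].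
have q0 : 0 < s t `^ 2^-1 by rewrite powR_gt0.
have q2 : (s t `^ 2^-1) ^+ 2 = s t by rewrite powR12_sqrt ?sqr_sqrtr ?ltW.
have tS : unit_sphere ((s t `^ 2^-1)^-1 *: tuple_col t).
  rewrite /unit_sphere/= dotvE; under eq_bigr do rewrite !mxE mulrACA.
  rewrite -mulr_sumr.
  have -> : \sum_i tnth t i * tnth t i = s t.
    by rewrite /s dotvE; apply: eq_bigr => i _; rewrite !mxE.
  by rewrite -invfM -expr2 q2 mulVf// gt_eqF.
exists (s t `^ 2^-1), (SigSub (mem_set tS)); split; [exact: q0| |exact: Bt|].
  by rewrite (powR12_sqrt (ltW s0)) -(@sqrtr1 R) ler_wsqrtr.
rewrite /sphere_val /= scalerA divff ?scale1r// gt_eqF//.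
Qed.

Lemma sphere_val_inj : injective (@sphere_val R n).
Proof. exact: val_inj. Qed.

Lemma coneE (A : set (sphere R n)) :
  let s t := dotv (tuple_col t) (tuple_col t) in
  cone A = [set t | 0 < s t <= 1] `&`
    (fun t => (s t `^ 2^-1)^-1 *: tuple_col t) @^-1` (@sphere_val R n @` A).
Proof.
move=> s; rewrite -cone_val; congr cone; apply/seteqP.
split=> [x Ax|x /= [y Ay /sphere_val_inj <-]//]; by exists x.
Qed.

Lemma cone0 : cone set0 = set0.
Proof. by rewrite coneE image_set0 preimage_set0 setI0. Qed.

Lemma coneI A B : cone (A `&` B) = cone A `&` cone B.
Proof.
rewrite !coneE; apply/seteqP; split => t /=.
  by move=> [st [x [Ax Bx] e]]; split; split => //; exists x.
move=> [[st [x Ax e]] [_ [y By]]]; rewrite -e => /sphere_val_inj yx.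
by split => //; exists x => //; split => //; rewrite -yx.
Qed.

Lemma cone_bigcup (F : (set (sphere R n))^nat) :
  cone (\bigcup_i F i) = \bigcup_i cone (F i).
Proof.
apply/seteqP; split => t.
  by move=> [r [x [r0 r1 [i _ Fx] e]]]; exists i => //; exists r, x.
by move=> [i _ [r [x [r0 r1 Fx e]]]]; exists r, x; split => //; exists i.
Qed.

Lemma coneD A : cone (setT `\` A) = cone setT `\` cone A.
Proof.
apply/seteqP; split => t.
  move=> tD; split.
    by move: tD => [r [x [r0 r1 _ e]]]; exists r, x.
  move=> tA; have : cone ((setT `\` A) `&` A) t by rewrite coneI.
  by rewrite setDKI cone0.
move=> [[r [x [r0 r1 _ e]]] tA]; exists r, x; split => //; split => // Ax.
by apply: tA; exists r, x.
Qed.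

Lemma measurable_tnthR i : measurable_fun
  [set: n.+1.-tuple (measurableTypeR R)] (fun t => tnth t i : R).
Proof. exact: measurable_tnth. Qed.

Lemma measurable_cone (A : set (sphere R n)) :
  measurable A -> measurable (cone A).
Proof.
have ms : measurable_fun [set: n.+1.-tuple (measurableTypeR R)]
    (fun t => dotv (tuple_col t) (tuple_col t) : R).
  rewrite (_ : (fun t => _) = fun t => \sum_i (tnth t i : R) * tnth t i).
    apply: measurable_sum => i.
    by apply: measurable_funM; exact: measurable_tnthR.
  by apply/funext => t; rewrite dotvE; apply: eq_bigr => i _; rewrite !mxE.
have mopen U : open U -> measurable (cone (@sphere_val R n @^-1` U)).
  move=> oU; rewrite cone_val; apply: measurableI.
    rewrite (_ : [set t | _] = (fun t => dotv (tuple_col t) (tuple_col t)) @^-1`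
        `]0, 1]%classic); last by apply/seteqP; split => t /=; rewrite in_itv.
    by rewrite -[X in measurable X]setTI; apply: ms => //; exact: measurable_itv.
  apply: measurable_preimage_open => // i.
  under eq_fun do rewrite !mxE -powRN.
  apply: measurable_funM; last exact: measurable_tnthR.
  exact: (measurableT_comp (measurable_powR (- 2^-1)) ms).
have coneT : measurable (cone setT).
  by rewrite -(preimage_setT (@sphere_val R n)); apply: mopen; exact: openT.
move=> mA; pose C := [set A : set (sphere R n) | measurable (cone A)].
suff : <<s @open (sphere R n) >> `<=` C by exact.
apply: smallest_sub => [|U [V oV <-]]; last exact: mopen.
split.
- by rewrite /C/= cone0.
- by move=> B mB; rewrite /C/= coneD; exact: measurableD.
- by move=> F mF; rewrite /C/= cone_bigcup; exact: bigcupT_measurable.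
Qed.

(* Polar coordinates: dx = r^n dr dsigma in R^(n+1), so that the part of the
   unit ball lying over A has volume sigma(A) / (n+1). *)
Definition surface_area (A : set (sphere R n)) : \bar R :=
  (n.+1%:R%:E * lebesgue_tuple R n.+1 (cone A))%E.

Let surface_area0 : surface_area set0 = 0%E.
Proof. by rewrite /surface_area cone0 measure0 mule0. Qed.

Let surface_area_ge0 A : (0 <= surface_area A)%E.
Proof. by rewrite /surface_area mule_ge0. Qed.

Let surface_area_sigma_additive : semi_sigma_additive surface_area.
Proof.
move=> F mF tF mUF; rewrite /surface_area cone_bigcup.
rewrite [X in X @ _ --> _](_ : _ = fun k => n.+1%:R%:E *
    \sum_(0 <= i < k) lebesgue_tuple R n.+1 (cone (F i)))%E; last first.
  by apply/funext => k; rewrite ge0_sume_distrr.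
apply: cvgeZl => //.
apply: measure_semi_sigma_additive.
- by move=> i; exact: measurable_cone.
- apply/trivIsetP => i j _ _ ij; rewrite -coneI.
  by move/trivIsetP : tF => /(_ _ _ _ _ ij) ->//; exact: cone0.
- by apply: bigcupT_measurable => i; exact: measurable_cone.
Qed.

HB.instance Definition _ := isMeasure.Build _ _ _ surface_area
  surface_area0 surface_area_ge0 surface_area_sigma_additive.

End surface_area.

Section depth.
Context (R : realType) (n : nat).
Implicit Types (d : sphere R n -> sphere R n -> R) (x y z : sphere R n).

Definition is_metric d : Prop :=
  [/\ forall x y, 0 <= d x y,
      forall x y, d x y = 0 <-> x = y,
      forall x y, d x y = d y x &
      forall x y z, d x z <= d x y + d y z].

Definition rotation_invariant d : Prop :=
  forall O : 'M[R]_n.+1, O^T *m O = 1%:M ->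
  forall x y x' y',
    sphere_val x' = O *m sphere_val x -> sphere_val y' = O *m sphere_val y ->
    d x' y' = d x y.

Definition has_density (H : probability (sphere R n) R) (f : sphere R n -> R) :
    Prop :=
  [/\ measurable_fun [set: sphere R n] f,
      forall x, 0 <= f x &
      forall A, measurable A ->
        H A = (\int[@surface_area R n]_(x in A) (f x)%:E)%E].

(* Meaningful for a bounded d only: the supremum of an unbounded set of reals
   is 0 by convention. *)
Definition dist_sup d : R :=
  sup [set d p.1 p.2 | p in [set: sphere R n * sphere R n]].

Definition depth d x (H : probability (sphere R n) R) : \bar R :=
  ((dist_sup d)%:E - 'E_H[d x])%E.

End depth.

(* Main.v *)
Require Import Defs.
From mathcomp Require Import all_boot all_order all_algebra.
From mathcomp Require Import all_classical all_reals all_analysis.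
From mathcomp Require Import measurable_realfun ring lra.
Import Order.TTheory GRing.Theory Num.Theory.
Import numFieldNormedType.Exports.
Local Open Scope classical_set_scope.
Local Open Scope ring_scope.

Set Implicit Arguments.
Unset Strict Implicit.

(** The depth of a point is a constant minus its mean distance
    [E(a) = int delta (a . x) f x dsigma], where [f x = c h (x . theta0)], so
    the claim is that [E] is a strictly decreasing function of [a . theta0].

    Take [a . theta0 > b . theta0], put [w = a - b], and let [r] be the
    reflection in the hyperplane orthogonal to [w].  It exchanges [a] and [b]
    and preserves the surface measure, so each of [E(a)] and [E(b)] is also
    obtained by exchanging [a] with [b] and [f] with [f o r].  Averaging,
    [2 (E(b) - E(a))] is the integral of
    [(delta (b . x) - delta (a . x)) (f x - f (r x))].
    Both factors have the sign of [w . x]: the first because [delta] decreases,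
    the second because [x . theta0 - r x . theta0] is a positive multiple of
    [w . x] and [h] increases.  Hence the integrand is positive off the great
    subsphere [w . x = 0] ([mean_dist_lt]).  Were the integral zero, the
    surface measure would live on that subsphere; moving it by reflections, it
    would live on every coordinate subsphere [x_i = 0], and these have no
    common point, so it would vanish ([surface_area_hyperplane]), against [f]
    being a probability density.  The same reflection shows that [E(a)] depends
    on [a . theta0] only ([mean_dist_eq]).

    The substance is the invariance of the surface measure, which reduces to
    that of Lebesgue measure [lambda] on R^k under an orthogonal [O]
    ([lebesgue_tuple_orthogonalM]).  No change of variables formula is used:
    for a set [B] with [- O B = B], compute the measure of
    [{(x, y) | O x in A, y - O x in B}] in the two orders of integration.
    Translation invariance gives [lambda (O^-1 A) lambda B] one way and
    [lambda A lambda B] the other, and [lambda B] cancels when [B] is the unit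
    ball. *)

(** * Translation invariance of Lebesgue measure on tuples *)

Lemma lebesgue_measure_shift (R : realType) (a : R) (A : set R) :
  measurable A ->
  pushforward (@lebesgue_measure R)
    (fun x : measurableTypeR R => x + a : measurableTypeR R) A =
  lebesgue_measure A.
Proof.
move=> mA.
pose phi (x : measurableTypeR R) : measurableTypeR R := x + a.
have mphi : measurable_fun setT phi by exact: measurable_funD.
apply/esym/lebesgue_measure_unique => //; move=> _ [[u v]] _ <-.
rewrite /pushforward.
rewrite [X in _ = lebesgue_measure X](_ : _ = `]u - a, v - a]%classic);
  last first.
  by apply/seteqP; split => x /=; rewrite /phi !in_itv/= ltrBlDr lerBrDr.
rewrite !lebesgue_measure_itv/= !lte_fin ltrD2r.
by case: ifP => // _; rewrite -!EFinB; congr EFin; lra.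
Qed.

Definition shift_tuple (R : realType) k (a : 'cV[R]_k)
    (t : k.-tuple (measurableTypeR R)) : k.-tuple (measurableTypeR R) :=
  [tuple tnth t i + a i 0 | i < k].

Lemma shift_tuple_cons (R : realType) k (a : 'cV[R]_k.+1) x
    (t : k.-tuple (measurableTypeR R)) :
  shift_tuple a (cons_pair (x, t)) =
  cons_pair (x + a ord0 0, shift_tuple (\col_i a (lift ord0 i) 0) t).
Proof.
apply: eq_from_tnth => i; rewrite tnth_mktuple.
case: (unliftP ord0 i) => [j|] ->; rewrite ?tnth0 //.
by rewrite !tnthS tnth_mktuple mxE.
Qed.

Lemma measurable_preimage d1 d2 (T1 : measurableType d1) (T2 : measurableType d2)
  (f : T1 -> T2) A : measurable_fun setT f -> measurable A ->
  measurable (f @^-1` A).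
Proof. by move=> mf mA; rewrite -[X in measurable X]setTI; exact: mf. Qed.

Lemma lebesgue_tuple_consE (R : realType) k
    (A : set (k.+1.-tuple (measurableTypeR R))) :
  (lebesgue_tuple R k.+1 A =
  \int[@lebesgue_measure R]_x
     lebesgue_tuple R k ((fun t => cons_pair (x, t)) @^-1` A))%E.
Proof.
apply: eq_integral => x _ /=; congr (lebesgue_tuple _ _ _).
by apply/seteqP; split => t; rewrite /xsection /= inE.
Qed.

(** By induction on the dimension: the tail is shifted inside the integral over
    the first coordinate, which is then shifted as a real number. *)
Lemma lebesgue_tuple_shift (R : realType) k (a : 'cV[R]_k) A : measurable A ->
  lebesgue_tuple R k (shift_tuple a @^-1` A) = lebesgue_tuple R k A.
Proof.
elim: k a A => [|k IH] a A mA.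
  rewrite (_ : _ @^-1` A = A)//.
  by apply: funext => t; rewrite /preimage/= (tuple0 (shift_tuple a t)) -(tuple0 t).
pose F (x : measurableTypeR R) :=
  lebesgue_tuple R k ((fun t => cons_pair (x, t)) @^-1` A).
have mc x : measurable_fun setT
    (fun t : k.-tuple (measurableTypeR R) => cons_pair (x, t)).
  exact: (measurable_cons (measurable_cst x) (@measurable_id _ _ setT)).
have mF : measurable_fun setT F.
  rewrite (_ : F = lebesgue_tuple R k \o
      xsection (@cons_pair _ (measurableTypeR R) k @^-1` A)).
    apply: measurable_fun_xsection; apply: measurable_preimage => //.
    exact: measurable_cons_pair.
  apply/funext => x /=; congr (lebesgue_tuple _ _ _).
  by apply/seteqP; split => t; rewrite /xsection /= inE.
rewrite !lebesgue_tuple_consE.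
under eq_integral => x _.
  rewrite (_ : _ @^-1` _ = shift_tuple (\col_i a (lift ord0 i) 0) @^-1`
     ((fun t => cons_pair (x + a ord0 0, t)) @^-1` A)); last first.
    by apply/seteqP; split => t /=; rewrite shift_tuple_cons.
  rewrite IH; last exact: measurable_preimage (mc _) mA.
  rewrite -/(F (x + a ord0 0)).
  over.
have mshift : measurable_fun setT
    (fun x : measurableTypeR R => x + a ord0 0 : measurableTypeR R).
  exact: measurable_funD.
have F0 : {in setT, forall x, (0 <= F x)%E} by move=> x _; exact: measure_ge0.
have := ge0_integral_pushforward mshift lebesgue_measure measurableT mF F0.
rewrite preimage_setT /= => <-.
by apply: eq_measure_integral => B mB _; exact: lebesgue_measure_shift.
Qed.

(** * Orthogonal invariance of Lebesgue measure on tuples *)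

Definition col_tuple (R : realType) k (v : 'cV[R]_k) :
    k.-tuple (measurableTypeR R) := [tuple v i 0 | i < k].

Lemma col_tupleK (R : realType) k : cancel (@col_tuple R k) (@tuple_col R k).
Proof.
by move=> v; apply/matrixP => i j; rewrite mxE tnth_mktuple (ord1 j).
Qed.

Lemma shift_tupleE (R : realType) k (a : 'cV[R]_k) t :
  shift_tuple a t = col_tuple (tuple_col t + a).
Proof. by apply: eq_from_tnth => i; rewrite !tnth_mktuple !mxE. Qed.

Definition mul_tuple (R : realType) k (M : 'M[R]_k)
    (t : k.-tuple (measurableTypeR R)) := col_tuple (M *m tuple_col t).

Lemma measurable_mul_tuple (R : realType) k (M : 'M[R]_k) :
  measurable_fun setT (mul_tuple M).
Proof.
apply/measurable_fun_tnthP => i.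
rewrite (_ : _ \o _ = fun t => \sum_j M i j * (tnth t j : R)); last first.
  apply: funext => t /=; rewrite tnth_mktuple mxE.
  by apply: eq_bigr => j _; rewrite mxE.
apply: measurable_sum => j; apply: measurable_funM => //.
exact: measurable_tnth.
Qed.

Definition add_tuple (R : realType) k
    (p : k.-tuple (measurableTypeR R) * k.-tuple (measurableTypeR R)) :=
  col_tuple (tuple_col p.1 + tuple_col p.2).

Lemma measurable_add_tuple (R : realType) k :
  measurable_fun setT (@add_tuple R k).
Proof.
apply/measurable_fun_tnthP => i.
rewrite (_ : _ \o _ = fun p => tnth p.1 i + tnth p.2 i); last first.
  by apply: funext => p /=; rewrite tnth_mktuple !mxE.
apply: measurable_funD.
  exact: (measurableT_comp (measurable_tnth i) measurable_fst).
exact: (measurableT_comp (measurable_tnth i) measurable_snd).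
Qed.

(** Tonelli for an indicator function, with the sections written as
    comprehensions. *)
Lemma fubini_set d1 d2 (T1 : measurableType d1) (T2 : measurableType d2)
    (R : realType) (m1 : {sigma_finite_measure set T1 -> \bar R})
    (m2 : {sigma_finite_measure set T2 -> \bar R}) (E : set (T1 * T2)) :
  measurable E ->
  (\int[m1]_x m2 [set y | E (x, y)] = \int[m2]_y m1 [set x | E (x, y)])%E.
Proof.
move=> mE; have := @product_measure_unique _ _ _ _ _ m1 m2 (m1 \x^ m2)%E
  (fun A B mA mB => product_measure2E m1 m2 mA mB) E mE.
rewrite /product_measure1 /product_measure2.
under eq_integral => x _.
  rewrite [X in X x]/comp (_ : xsection _ _ = [set y | E (x, y)]); last first.
    by apply/seteqP; split => t; rewrite /xsection /= inE.
  over.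
move=> ->; apply: eq_integral => y _; congr (m1 _).
by apply/seteqP; split => t; rewrite /ysection /= inE.
Qed.

Lemma integral_if d (T : measurableType d) (R : realType)
    (m : {measure set T -> \bar R}) (F : T -> \bar R) (C : set T) (a : \bar R) :
  measurable C -> (0 <= a)%E -> (forall x, C x -> F x = a) ->
  (forall x, ~ C x -> F x = 0%E) ->
  (\int[m]_x F x = m C * a)%E.
Proof.
move=> mC a0 FC FNC.
under eq_integral => x _.
  rewrite (_ : F x = (\1_C x)%:E * a)%E; last first.
    rewrite indicE; have [xC|xC] := boolP (x \in C).
      by rewrite mul1e FC//; rewrite inE in xC.
    by rewrite mul0e FNC//; rewrite notin_setE in xC.
  over.
by rewrite ge0_integralZr ?integral_indic ?setIT//; exact: measurableT_comp.
Qed.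

(** The measure of the set [E] below, computed by integrating over [y] first,
    factors as the left-hand side, because [y] only enters through a translate
    of [B].  Integrating over [x] first, the substitution [x := x + O^T y] turns
    [E] into [E'], whose measure factors as the right-hand side, because [y] now
    only enters through a translate of [A]. *)
Lemma lebesgue_tuple_orthogonalM (R : realType) k (O : 'M[R]_k)
    (A B : set (k.-tuple (measurableTypeR R))) :
  O^T *m O = 1%:M -> measurable A -> measurable B ->
  (forall t, B (mul_tuple (- O) t) <-> B t) ->
  (lebesgue_tuple R k (mul_tuple O @^-1` A) * lebesgue_tuple R k B =
   lebesgue_tuple R k A * lebesgue_tuple R k B)%E.
Proof.
move=> OTO mA mB BO; set lam := lebesgue_tuple R k.
pose T := k.-tuple (measurableTypeR R).
have mO := measurable_mul_tuple O; have mNO := measurable_mul_tuple (- O).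
have mx2 : measurable_fun setT (fun p : T * T => (mul_tuple (- O) p.1, p.2)).
  apply: measurable_fun_pair => //.
  exact: (measurableT_comp mNO measurable_fst).
have mx1 : measurable_fun setT (fun p : T * T => (mul_tuple O p.1, p.2)).
  apply: measurable_fun_pair => //.
  exact: (measurableT_comp mO measurable_fst).
have mD := @measurable_add_tuple R k.
pose E := (mul_tuple O \o fst) @^-1` A `&`
  (fun p : T * T => add_tuple (mul_tuple (- O) p.1, p.2)) @^-1` B.
have mE : measurable E.
  apply: measurableI.
    by apply: measurable_preimage mA; exact: (measurableT_comp mO measurable_fst).
  by apply: measurable_preimage mB; exact: (measurableT_comp mD mx2).
pose E' := (fst @^-1` B) `&`
  (fun p : T * T => add_tuple (mul_tuple O p.1, p.2)) @^-1` A.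
have mE' : measurable E'.
  apply: measurableI.
    by apply: measurable_preimage mB; exact: measurable_fst.
  by apply: measurable_preimage mA; exact: (measurableT_comp mD mx1).
have mOA := measurable_preimage mO mA.
transitivity (\int[lam]_x lam [set y | E (x, y)])%E.
  apply/esym/integral_if => // x.
    move=> Ax; rewrite -(lebesgue_tuple_shift (- (O *m tuple_col x)) mB).
    congr (lam _); apply/seteqP.
    split => t; rewrite /E /= shift_tupleE /add_tuple/= col_tupleK mulNmx addrC//.
    by case.
  move=> nAx; rewrite (_ : mkset _ = set0) ?measure0//.
  by apply/seteqP; split => t // -[].
rewrite fubini_set//.
transitivity (\int[lam]_y lam [set x | E' (x, y)])%E.
  apply: eq_integral => y _.
  have mEy : measurable [set x | E (x, y)].
    apply: measurable_preimage mE; exact: measurable_pair2.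
  rewrite -(lebesgue_tuple_shift (O^T *m tuple_col y) mEy).
  congr (lam _); apply/seteqP.
  have OOT : O *m O^T = 1%:M by exact: mulmx1C.
  have e1 t : mul_tuple O (shift_tuple (O^T *m tuple_col y) t) =
      add_tuple (mul_tuple O t, y).
    rewrite /mul_tuple shift_tupleE /add_tuple/= !col_tupleK mulmxDr mulmxA OOT.
    by rewrite mul1mx.
  have e2 t : add_tuple (mul_tuple (- O) (shift_tuple (O^T *m tuple_col y) t), y) =
      mul_tuple (- O) t.
    rewrite /mul_tuple shift_tupleE /add_tuple/= !col_tupleK mulmxDr.
    by rewrite (mulmxA (- O)) !mulNmx OOT mul1mx subrK.
  by split => t; rewrite /E /E' /= e1 e2 => -[? ?]; split => //; exact/BO.
rewrite -fubini_set// muleC; apply: integral_if => // x.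
  move=> Bx; rewrite -(lebesgue_tuple_shift (O *m tuple_col x) mA).
  congr (lam _); apply/seteqP.
  split => t; rewrite /E' /= shift_tupleE /add_tuple/= col_tupleK addrC//.
  by case.
move=> nBx; rewrite (_ : mkset _ = set0) ?measure0//.
by apply/seteqP; split => t // -[].
Qed.

(** * Rotation invariance of the surface measure *)

Lemma lebesgue_tuple_box_lty (R : realType) k :
  (lebesgue_tuple R k [set t | forall i, (-1 <= tnth t i <= 1)%R] < +oo)%E.
Proof.
elim: k => [|k IH]; first by rewrite /= diracE ltry.
rewrite lebesgue_tuple_consE.
have itv_lty : (@lebesgue_measure R `[(-1)%R, 1%R]%classic < +oo)%E.
  by rewrite lebesgue_measure_itv/=; case: ifP => _; rewrite -?EFinB ltry.
rewrite (@integral_if _ _ _ _ _ (`[-1, 1]%classic : set (measurableTypeR R))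
  (lebesgue_tuple R k [set t | forall i, (-1 <= tnth t i <= 1)%R])) //.
- by rewrite lte_mul_pinfty// ?ge0_fin_numE// itv_lty.
- move=> x; rewrite /= in_itv/= => x1; congr (lebesgue_tuple R k _).
  apply/seteqP; split => t /= H i.
    by have := H (lift ord0 i); rewrite tnthS.
  by case: (unliftP ord0 i) => [j|] ->; rewrite ?tnthS ?tnth0.
- move=> x; rewrite /= in_itv/= => x1.
  rewrite [X in lebesgue_tuple R k X](_ : _ = set0) ?measure0//.
  by apply/seteqP; split => t //= /(_ ord0); rewrite tnth0.
Qed.

Lemma dotv_mulmx (R : realType) k (M : 'M[R]_k) (x y : 'cV[R]_k) :
  dotv (M *m x) y = dotv x (M^T *m y).
Proof. by rewrite /dotv trmx_mul mulmxA. Qed.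

Lemma unit_sphere_mulmx (R : realType) n (M : 'M[R]_n.+1) (x : sphere R n) :
  M^T *m M = 1%:M -> unit_sphere (M *m sphere_val x).
Proof.
by move=> MM; rewrite /unit_sphere/= dotv_mulmx mulmxA MM mul1mx (set_valP x).
Qed.

Definition rotate (R : realType) n (M : 'M[R]_n.+1) (MM : M^T *m M = 1%:M)
    (x : sphere R n) : sphere R n := SigSub (mem_set (unit_sphere_mulmx x MM)).

Lemma rotateE (R : realType) n (M : 'M[R]_n.+1) (MM : M^T *m M = 1%:M) x :
  sphere_val (rotate MM x) = M *m sphere_val x.
Proof. by []. Qed.

Lemma sphere_coord_le1 (R : realType) n (x : sphere R n) i :
  `|sphere_val x i 0| <= 1.
Proof.
rewrite -(@expr_le1 _ 2)// real_normK ?num_real//.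
rewrite -[leRHS](set_valP x) -/(sphere_val x) dotvE (bigD1 i)//= -expr2 lerDl.
by apply: sumr_ge0 => j _; rewrite -expr2 sqr_ge0.
Qed.

Lemma cone_rotate (R : realType) n (M : 'M[R]_n.+1) (MM : M^T *m M = 1%:M)
    (A : set (sphere R n)) :
  cone (rotate MM @^-1` A) = mul_tuple M @^-1` cone A.
Proof.
apply/seteqP; split => t [r [x [r0 r1 Ax e]]].
  exists r, (rotate MM x); split => //.
  by rewrite /mul_tuple col_tupleK e -scalemxAr.
have MM' : M^T^T *m M^T = 1%:M by rewrite trmxK; exact: mulmx1C.
exists r, (rotate MM' x); split => //.
  rewrite /preimage /= (_ : rotate MM _ = x)//; apply: sphere_val_inj.
  by rewrite !rotateE mulmxA (mulmx1C MM) mul1mx.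
rewrite rotateE scalemxAr -e /mul_tuple col_tupleK mulmxA MM mul1mx//.
Qed.

(** The solid unit ball without its centre, which is the cone over the whole
    sphere, is the auxiliary set [B] of [lebesgue_tuple_orthogonalM].  Its
    volume can be cancelled unless it is zero, and then every cone is null. *)
Lemma surface_area_rotate (R : realType) n (M : 'M[R]_n.+1)
    (MM : M^T *m M = 1%:M) (A : set (sphere R n)) : measurable A ->
  surface_area (rotate MM @^-1` A) = surface_area A.
Proof.
move=> mA; rewrite /surface_area cone_rotate; congr (_ * _)%E.
pose B := cone (@setT (sphere R n)).
have mB : measurable B by exact: measurable_cone.
have mcA := measurable_cone mA.
have Boo : (lebesgue_tuple R n.+1 B < +oo)%E.
  apply: le_lt_trans (lebesgue_tuple_box_lty R n.+1).
  have mbox : measurable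
      [set t : n.+1.-tuple (measurableTypeR R) | forall i, (-1 <= tnth t i <= 1)%R].
    rewrite (_ : mkset _ =
        \bigcap_i ((fun t => tnth t i : R) @^-1` `[-1, 1]%classic)).
      apply: fin_bigcap_measurable => // i _.
      apply: measurable_preimage; last exact: measurable_itv.
      exact: measurable_tnthR.
    apply/seteqP; split => t /=.
      by move=> H i _ /=; rewrite in_itv/=.
    by move=> H i; have := H i I; rewrite /= in_itv.
  apply: le_measure; rewrite ?inE//.
  move=> t [r [x [r0 r1 _ e]]] i; rewrite -ler_norml.
  have -> : tnth t i = tuple_col t i 0 by rewrite mxE.
  rewrite e mxE normrM mulr_ile1// ?sphere_coord_le1//.
  by rewrite ger0_norm// ltW.
have NMM : (- M)^T *m (- M) = 1%:M.
  have -> : (- M)^T = - M^T by apply/matrixP => i j; rewrite !mxE.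
  by rewrite mulNmx mulmxN opprK.
have BM t : B (mul_tuple (- M) t) <-> B t.
  have := cone_rotate NMM setT; rewrite preimage_setT => BE.
  by rewrite /B [in X in _ <-> X]BE.
have [B0|B0] := eqVneq (lebesgue_tuple R n.+1 B) 0%E.
  have C0 C : measurable C -> C `<=` B -> lebesgue_tuple R n.+1 C = 0%E.
    by move=> mC CB; exact: (subset_measure0 mC mB CB B0).
  rewrite !C0//.
  - by move=> t [r [x [r0 r1 _ e]]]; exists r, x.
  - exact: measurable_preimage (measurable_mul_tuple M) mcA.
  - rewrite -cone_rotate => t [r [x [r0 r1 _ e]]]; by exists r, x.
have Bfin : lebesgue_tuple R n.+1 B \is a fin_num by rewrite ge0_fin_numE.
have := lebesgue_tuple_orthogonalM MM mcA mB BM.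
move: B0; rewrite -(fineK Bfin); set b := fine _; rewrite eqe => b0.
move=> /(congr1 (fun y => y * (b^-1)%:E)%E).
by rewrite -!muleA -EFinM divff// !mule1.
Qed.

(** * Integration on the sphere *)

Lemma measurable_coord (R : realType) n i :
  measurable_fun setT (fun x : sphere R n => sphere_val x i 0 : R).
Proof.
apply: (measurability _ (RGenOpens.measurableE R)).
move=> _ [_ [a [b ->] <-]]; rewrite setTI; apply: sub_sigma_algebra.
exists ((fun y : 'cV[R]_n.+1 => y i 0) @^-1` `]a, b[%classic) => //.
apply: open_comp; last exact: interval_open.
by move=> y _; exact: coord_continuous.
Qed.

Lemma measurable_dotv (R : realType) n (w : 'cV[R]_n.+1) :
  measurable_fun setT (fun x : sphere R n => dotv w (sphere_val x)).
Proof.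
rewrite (_ : (fun x => _) =
    fun x : sphere R n => \sum_i w i 0 * (sphere_val x i 0 : R)).
  apply: measurable_sum => i; apply: measurable_funM => //.
  exact: measurable_coord.
by apply: funext => x; rewrite dotvE.
Qed.

Lemma measurable_rotate (R : realType) n (M : 'M[R]_n.+1)
    (MM : M^T *m M = 1%:M) : measurable_fun setT (rotate MM).
Proof.
apply: (@measurability _ _ _ _ _ _ (@open (sphere R n))) => //.
move=> _ [_ [U oU <-] <-]; rewrite setTI.
apply: (@measurable_preimage_open _ _ _ _ (fun x => M *m sphere_val x)) => // i.
rewrite (_ : (fun x => _) = fun x : sphere R n => dotv ((row i M)^T) (sphere_val x)).
  exact: measurable_dotv.
by apply: funext => x; rewrite dotvE mxE; apply: eq_bigr => j _; rewrite !mxE.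
Qed.

Lemma integral_rotate (R : realType) n (M : 'M[R]_n.+1)
    (MM : M^T *m M = 1%:M) (F : sphere R n -> \bar R) :
  measurable_fun setT F -> (forall x, 0 <= F x)%E ->
  (\int[@surface_area R n]_x F (rotate MM x) =
   \int[@surface_area R n]_x F x)%E.
Proof.
move=> mF F0; have mr := measurable_rotate MM.
have F0' : {in setT, forall x, (0 <= F x)%E} by [].
have := ge0_integral_pushforward mr (@surface_area R n) measurableT mF F0'.
rewrite preimage_setT /= => <-.
by apply: eq_measure_integral => A mA _; exact: surface_area_rotate.
Qed.

Import HBNNSimple.

(** The defining identity of a density is the case of an indicator function
    [g]; it extends to simple functions by additivity and to nonnegative
    functions by monotone convergence. *)
Lemma integral_density d (T : measurableType d) (R : realType)
    (mu nu : {measure set T -> \bar R}) (f : T -> R) (g : T -> \bar R) :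
  measurable_fun setT f -> (forall x, 0 <= f x) ->
  (forall A, measurable A -> nu A = (\int[mu]_(x in A) (f x)%:E)%E) ->
  measurable_fun setT g -> (forall x, 0 <= g x)%E ->
  (\int[nu]_x g x = \int[mu]_x (g x * (f x)%:E))%E.
Proof.
move=> mf f0 nuE mg g0.
have mEf : measurable_fun setT (EFin \o f) by exact/measurable_EFinP.
have f0' x : (0 <= (f x)%:E)%E by rewrite lee_fin.
pose s := nnsfun_approx measurableT mg.
have s0 n x : (0 <= (s n x)%:E)%E by rewrite lee_fin.
have ms n : measurable_fun setT (fun x => (s n x)%:E).
  exact/measurable_EFinP/measurable_funP.
have nds x : {homo (fun n => (s n x)%:E) : a b / (a <= b)%N >-> (a <= b)%E}.
  by move=> a b ab; rewrite lee_fin; exact/lefP/nd_nnsfun_approx.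
have cvs x : (fun n => (s n x)%:E) @ \oo --> g x.
  exact: cvg_nnsfun_approx.
transitivity (limn (fun n => \int[nu]_x (s n x)%:E)%E).
  rewrite -monotone_convergence//.
  by apply: eq_integral => x _; apply/esym/cvg_lim.
transitivity (limn (fun n => \int[mu]_x ((s n x)%:E * (f x)%:E))%E); last first.
  rewrite -monotone_convergence//.
  - apply: eq_integral => x _; apply/cvg_lim => //.
    by apply: cvgeZr => //; exact: cvs.
  - by move=> n; apply: emeasurable_funM.
  - by move=> n x _; apply: mule_ge0.
  - by move=> x _ a b ab; apply: lee_wpmul2r => //; exact: nds.
congr (limn _); apply: funext => n.
have mk k : measurable (s n @^-1` [set k]) by exact: measurable_funPTI.
transitivity (\sum_(k \in range (s n)) (k%:E * nu (s n @^-1` [set k])))%E.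
  under eq_integral do rewrite fimfunE -fsumEFin//.
  rewrite ge0_integral_fsum//; last 2 first.
  - by move=> y; exact/measurable_EFinP/measurable_funM.
  - by move=> y x _; rewrite nnfun_muleindic_ge0.
  by apply: eq_fsbigr => r _; rewrite integralZl_indic_nnsfun// integral_indic//= setIT.
transitivity (\sum_(k \in range (s n))
    \int[mu]_x ((k * \1_(s n @^-1` [set k]) x)%:E * (f x)%:E))%E.
  apply: eq_fsbigr => k; rewrite inE => -[y _ <-{k}].
  have sy : (0 <= s n y)%R by [].
  rewrite nuE// integral_mkcond -ge0_integralZl//.
  - apply: eq_integral => x _; rewrite EFinM -muleA; congr (_ * _)%E.
    rewrite patchE indicE; case: ifPn => _; first by rewrite mul1e.
    by rewrite mul0e.
  - by apply/(measurable_restrictT _ (mk _)) => //; exact: measurable_funTS.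
  - by move=> x _; rewrite patchE; case: ifP.
rewrite -ge0_integral_fsum//.
- apply: eq_integral => x _; rewrite -ge0_mule_fsuml.
    by rewrite fsumEFin// -fimfunE.
  by move=> k; rewrite nnfun_muleindic_ge0.
- move=> k; apply: emeasurable_funM => //.
  exact/measurable_EFinP/measurable_funM.
- by move=> k x _; rewrite mule_ge0// nnfun_muleindic_ge0.
Qed.

(** * Dot products and reflections *)

Lemma dotvC (R : realType) k (x y : 'cV[R]_k) : dotv x y = dotv y x.
Proof. by rewrite !dotvE; apply: eq_bigr => i _; rewrite mulrC. Qed.

Lemma dotvDr (R : realType) k (x y z : 'cV[R]_k) :
  dotv x (y + z) = dotv x y + dotv x z.
Proof. by rewrite /dotv mulmxDr mxE. Qed.

Lemma dotvZr (R : realType) k a (x y : 'cV[R]_k) :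
  dotv x (a *: y) = a * dotv x y.
Proof. by rewrite /dotv -scalemxAr mxE. Qed.

Lemma dotvDl (R : realType) k (x y z : 'cV[R]_k) :
  dotv (y + z) x = dotv y x + dotv z x.
Proof. by rewrite dotvC dotvDr !(dotvC x). Qed.

Lemma dotvZl (R : realType) k a (x y : 'cV[R]_k) :
  dotv (a *: y) x = a * dotv y x.
Proof. by rewrite dotvC dotvZr (dotvC x). Qed.

Lemma dotvBr (R : realType) k (x y z : 'cV[R]_k) :
  dotv x (y - z) = dotv x y - dotv x z.
Proof. by rewrite -scaleN1r dotvDr dotvZr mulN1r. Qed.

Lemma dotvBl (R : realType) k (x y z : 'cV[R]_k) :
  dotv (y - z) x = dotv y x - dotv z x.
Proof. by rewrite dotvC dotvBr !(dotvC x). Qed.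

Lemma dotv_delta (R : realType) k i (x : 'cV[R]_k) :
  dotv (delta_mx i 0) x = x i 0.
Proof. by rewrite /dotv trmx_delta -rowE mxE. Qed.

Lemma dotv_ge0 (R : realType) k (x : 'cV[R]_k) : 0 <= dotv x x.
Proof. by rewrite dotvE; apply: sumr_ge0 => i _; rewrite -expr2 sqr_ge0. Qed.

Lemma dotv_eq0 (R : realType) k (x : 'cV[R]_k) : (dotv x x == 0) = (x == 0).
Proof.
apply/eqP/eqP => [|->]; last by rewrite /dotv mulmx0 mxE.
rewrite dotvE => /eqP; rewrite psumr_eq0; last first.
  by move=> i _; rewrite -expr2 sqr_ge0.
move=> /allP x0; apply/matrixP => i j; rewrite (ord1 j) mxE.
by have := x0 i (mem_index_enum i); rewrite /= mulf_eq0 orbb => /eqP.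
Qed.

Lemma dotv_sphere (R : realType) n (x : sphere R n) :
  dotv (sphere_val x) (sphere_val x) = 1.
Proof. exact: set_valP x. Qed.

Lemma dotv_sphere_itv (R : realType) n (x y : sphere R n) :
  dotv (sphere_val x) (sphere_val y) \in `[-1, 1].
Proof.
have := dotv_ge0 (sphere_val x - sphere_val y).
have := dotv_ge0 (sphere_val x + sphere_val y).
rewrite !(dotvBl, dotvBr, dotvDl, dotvDr) !dotv_sphere (dotvC _ (sphere_val x)).
by move: (dotv _ _) => u *; rewrite in_itv/=; apply/andP; split; lra.
Qed.

Lemma dotv_sphere_lt1 (R : realType) n (x y : sphere R n) : x <> y ->
  dotv (sphere_val x) (sphere_val y) < 1.
Proof.
move=> xy; have : sphere_val x - sphere_val y != 0.
  by rewrite subr_eq0; apply/eqP => /sphere_val_inj.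
rewrite -dotv_eq0 neq_lt ltNge dotv_ge0/=.
rewrite !(dotvBl, dotvBr) !dotv_sphere (dotvC _ (sphere_val x)).
by move: (dotv _ _) => u *; lra.
Qed.

(** For [w = 0] the coefficient is [2 / 0 = 0] and the reflection is the
    identity, so the reflection exchanging two points is defined also when they
    coincide. *)
Definition reflection (R : realType) k (w : 'cV[R]_k) : 'M[R]_k :=
  1%:M - (2 / dotv w w) *: (w *m w^T).

Lemma reflectionE (R : realType) k (w x : 'cV[R]_k) :
  reflection w *m x = x - (2 * dotv w x / dotv w w) *: w.
Proof.
rewrite /reflection mulmxBl mul1mx -scalemxAl -mulmxA.
by rewrite [w^T *m x]mx11_scalar mul_mx_scalar scalerA mulrAC.
Qed.

Lemma trmx_reflection (R : realType) k (w : 'cV[R]_k) :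
  (reflection w)^T = reflection w.
Proof.
by apply/matrixP => i j; rewrite !mxE eq_sym; congr (_ - _ * _);
  apply: eq_bigr => l _; rewrite !mxE mulrC.
Qed.

Lemma reflectionK (R : realType) k (w x : 'cV[R]_k) :
  reflection w *m (reflection w *m x) = x.
Proof.
rewrite !reflectionE dotvBr dotvZr -addrA -opprD -scalerDl.
have [->|w0] := eqVneq w 0; first by rewrite scaler0 subr0.
have ww0 : dotv w w != 0 by rewrite dotv_eq0.
rewrite [X in X *: w](_ : _ = 0) ?scale0r ?subr0//.
by field.
Qed.

Lemma reflection_orthogonal (R : realType) k (w : 'cV[R]_k) :
  (reflection w)^T *m reflection w = 1%:M.
Proof.
rewrite trmx_reflection; apply/matrixP => i j.
have := reflectionK w (delta_mx j 0); rewrite mulmxA => /matrixP/(_ i 0).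
by rewrite -colE !mxE eqxx andbT.
Qed.

Lemma reflection_swap (R : realType) k (a b : 'cV[R]_k) :
  dotv a a = dotv b b -> reflection (a - b) *m a = b.
Proof.
move=> ab; rewrite reflectionE.
have [e|w0] := eqVneq (a - b) 0.
  by rewrite e scaler0 subr0; apply/eqP; rewrite -subr_eq0 e.
have ww0 : dotv (a - b) (a - b) != 0 by rewrite dotv_eq0.
rewrite (_ : _ / _ = 1) ?scale1r ?subKr//.
apply: (mulIf ww0); rewrite divfK// mul1r.
by rewrite !(dotvBl, dotvBr) (dotvC b a) ab; lra.
Qed.

(** The reflection taking [w] to [|w| e_i] carries the complement of the great
    subsphere orthogonal to [w] onto that of [x_i = 0].  If the former is null,
    so are the latter, for all [i], and they cover the sphere. *)
Lemma surface_area_hyperplane (R : realType) n (w : 'cV[R]_n.+1) : w != 0 ->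
  @surface_area R n [set x | dotv w (sphere_val x) != 0] = 0%E ->
  @surface_area R n setT = 0%E.
Proof.
move=> w0 sw0.
have mE (v : 'cV[R]_n.+1) :
    measurable [set x : sphere R n | dotv v (sphere_val x) != 0].
  rewrite (_ : mkset _ =
      (fun x : sphere R n => dotv v (sphere_val x)) @^-1` (~` [set 0])).
    apply: measurable_preimage; first exact: measurable_dotv.
    by apply: measurableC; exact: measurable_set1.
  by apply/seteqP; split => x /= /eqP.
have s0 : Num.sqrt (dotv w w) != 0.
  by rewrite sqrtr_eq0 -ltNge lt_neqAle eq_sym dotv_eq0 w0 dotv_ge0.
have coord0 i : @surface_area R n [set x | sphere_val x i 0 != 0] = 0%E.
  pose b : 'cV[R]_n.+1 := Num.sqrt (dotv w w) *: delta_mx i 0.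
  have bE x : dotv b x = Num.sqrt (dotv w w) * x i 0.
    by rewrite dotvZl dotv_delta.
  have bb : dotv w w = dotv b b.
    by rewrite bE mxE mxE !eqxx mulr1 -expr2 sqr_sqrtr// dotv_ge0.
  rewrite -sw0 -(surface_area_rotate (reflection_orthogonal (w - b)) (mE w)).
  congr (surface_area _); apply/seteqP; split => x /=;
    by rewrite rotateE dotvC dotv_mulmx trmx_reflection reflection_swap// dotvC bE
      mulf_eq0 (negbTE s0).
have mcoord i : measurable [set x : sphere R n | sphere_val x i 0 != 0].
  have := mE (delta_mx i 0); congr (measurable _).
  by apply/seteqP; split => x /=; rewrite dotv_delta.
rewrite (_ : setT = \bigcup_k [set x : sphere R n | sphere_val x (inord k) 0 != 0]).
  apply: measure_negligible; first by apply: bigcupT_measurable => k.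
  apply: negligible_bigcup => k.
  by exists [set x | sphere_val x (inord k) 0 != 0]; split => //; exact: coord0.
apply/seteqP; split => // x _; apply: contrapT => nx.
have := dotv_sphere x; rewrite dotvE big1; last first.
  move=> i _; have [->|xi] := eqVneq (sphere_val x i 0) 0; first by rewrite mul0r.
  by exfalso; apply: nx; exists (nat_of_ord i) => //=; rewrite inord_val.
by move=> /esym/eqP; rewrite oner_eq0.
Qed.

(** Nothing is known of [delta] outside [-1, 1], so it is composed with the
    projection onto that interval to get a monotone function on the whole
    line. *)
Lemma measurable_nonincreasing_dotv (R : realType) n (delta : R -> R)
    (a : sphere R n) :
  {in `[-1, 1] &, forall u v : R, u < v -> delta v < delta u} ->
  measurable_fun setT
    (fun x : sphere R n => delta (dotv (sphere_val a) (sphere_val x))).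
Proof.
move=> delta_decr; pose clamp (u : R) := Num.max (-1) (Num.min u 1).
have clampI u : clamp u \in `[-1, 1].
  rewrite in_itv/= /clamp le_max lexx/= ge_max ge_min lexx orbT andbT.
  by lra.
have mclamp : measurable_fun setT (delta \o clamp).
  apply: nonincreasing_measurable => // u v uv /=.
  have : clamp u <= clamp v.
    rewrite /clamp ge_max !le_max lexx !ge_min !le_min uv lexx/= !andbT.
    by have [_|/ltW v1] := leP 1 v; rewrite ?(le_trans uv v1) !orbT.
  rewrite le_eqVlt => /orP[/eqP ->//|cuv].
  by apply/ltW/delta_decr.
rewrite (_ : (fun x => _) = (delta \o clamp) \o
    (fun x : sphere R n => dotv (sphere_val a) (sphere_val x))).
  exact: (measurableT_comp mclamp (measurable_dotv _)).
apply: funext => x /=; congr delta; have := dotv_sphere_itv a x.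
by rewrite in_itv/= /clamp => /andP[u1 u2]; rewrite (min_idPl u2) (max_idPr u1).
Qed.

(** A vector [v] orthogonal to [theta0] exists as soon as the dimension is at
    least 2; the point is [u theta0 + s v], with [s] making it a unit vector.
    This is what lets the depth be read as a function on all of [-1, 1]. *)
Lemma exists_dotv_sphere (R : realType) n (theta0 : sphere R n) (u : R) :
  (0 < n)%N -> u \in `[-1, 1] ->
  exists x : sphere R n, dotv (sphere_val x) (sphere_val theta0) = u.
Proof.
move=> n0; rewrite in_itv/= => /andP[u1 u2].
have : kermx (sphere_val theta0) != 0.
  rewrite -mxrank_eq0 mxrank_ker -lt0n subn_gt0.
  by apply: leq_ltn_trans (rank_leq_col _) _; rewrite ltnS.
move=> /rowV0Pn[v /sub_kermxP v0 vn0].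
have vt : dotv v^T (sphere_val theta0) = 0 by rewrite /dotv trmxK v0 mxE.
have vv : 0 < dotv v^T v^T.
  rewrite lt_neqAle eq_sym dotv_eq0 dotv_ge0 andbT.
  by apply: contra vn0 => /eqP v0'; rewrite -(trmxK v) v0' trmx0.
pose s := Num.sqrt ((1 - u ^+ 2) / dotv v^T v^T).
have s2 : s ^+ 2 * dotv v^T v^T = 1 - u ^+ 2.
  rewrite sqr_sqrtr ?divfK ?gt_eqF// divr_ge0 ?(ltW vv)//.
  by rewrite subr_ge0 -(@real_normK _ u) ?num_real// exprn_ile1// ler_norml u1.
pose y := u *: sphere_val theta0 + s *: v^T.
have yS : unit_sphere y.
  rewrite /unit_sphere/= /y !(dotvDl, dotvDr, dotvZl, dotvZr) dotv_sphere.
  rewrite (dotvC _ v^T) vt; move: s2; move: (dotv _ _) => q s2.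
  by rewrite !mulr0 addr0 add0r mulr1 mulrA -!expr2 s2 addrC subrK.
exists (SigSub (mem_set yS)).
rewrite /sphere_val/= -/(sphere_val theta0) /y dotvDl !dotvZl dotv_sphere vt.
by rewrite mulr1 mulr0 addr0.
Qed.

(** * The mean distance under a rotationally symmetric density *)

Section rotationally_symmetric.
Context (R : realType) (n : nat) (delta : R -> R) (h : R -> R) (c : R).
Context (theta0 : sphere R n) (H : probability (sphere R n) R).

Definition dot (x y : sphere R n) : R := dotv (sphere_val x) (sphere_val y).

Definition density (x : sphere R n) : R := c * h (dot x theta0).

Definition mean_dist (a : sphere R n) : \bar R :=
  (\int[H]_x (delta (dot a x))%:E)%E.

Definition swap (a b : sphere R n) : sphere R n -> sphere R n :=
  rotate (reflection_orthogonal (sphere_val a - sphere_val b)).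

Local Notation sigma := (@surface_area R n).

Hypothesis delta_ge0 : {in `[-1, 1], forall u : R, 0 <= delta u}.
Hypothesis delta_decr :
  {in `[-1, 1] &, forall u v : R, u < v -> delta v < delta u}.
Hypothesis h_ge0 : {in `[-1, 1], forall u : R, 0 <= h u}.
Hypothesis h_incr : {in `[-1, 1] &, forall u v : R, u < v -> h u < h v}.
Hypothesis H_density : has_density H density.

Lemma delta_dot_ge0 a x : 0 <= delta (dot a x).
Proof. by apply: delta_ge0; exact: dotv_sphere_itv. Qed.

Lemma measurable_delta_dot a : measurable_fun setT (fun x => delta (dot a x)).
Proof. exact: measurable_nonincreasing_dotv. Qed.

Lemma mean_distE a :
  mean_dist a = (\int[sigma]_x (delta (dot a x) * density x)%:E)%E.
Proof.
have [mf f0 HE] := H_density.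
rewrite /mean_dist (integral_density (mu := sigma) mf f0 HE)//.
- by apply/measurable_EFinP; exact: measurable_delta_dot.
- by move=> x; rewrite lee_fin delta_dot_ge0.
Qed.

Lemma mean_dist_fin a : mean_dist a \is a fin_num.
Proof.
rewrite ge0_fin_numE; last first.
  by apply: integral_ge0 => x _; rewrite lee_fin delta_dot_ge0.
apply: (@le_lt_trans _ _ (\int[H]_x (delta (-1))%:E)%E); last first.
  by rewrite integral_cst//= probability_setT mule1 ltry.
apply: ge0_le_integral => //.
- by move=> x _; rewrite lee_fin delta_dot_ge0.
- by apply/measurable_EFinP; exact: measurable_delta_dot.
- move=> x _; rewrite lee_fin; have := dotv_sphere_itv a x.
  rewrite -/(dot a x); have [<-//|ne] := eqVneq (-1) (dot a x).
  move=> ax; apply/ltW/delta_decr => //; first by rewrite in_itv/= lexx; lra.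
  by rewrite lt_neqAle ne; move: ax; rewrite in_itv/= => /andP[].
Qed.

Lemma dot_swap a b x y : dot (swap a b x) y = dot x (swap a b y).
Proof. by rewrite /dot !rotateE dotv_mulmx trmx_reflection. Qed.

Lemma swap_left a b : swap a b a = b.
Proof.
by apply: sphere_val_inj; rewrite rotateE reflection_swap// !dotv_sphere.
Qed.

(** Substitute [x := swap a b x] in the integral: the reflection moves from [x]
    to [a] inside the distance, but stays in the density. *)
Lemma mean_dist_swap a b :
  mean_dist a = (\int[sigma]_x (delta (dot b x) * density (swap a b x))%:E)%E.
Proof.
have [mf f0 HE] := H_density.
rewrite mean_distE -(integral_rotate
  (reflection_orthogonal (sphere_val a - sphere_val b))).
- by apply: eq_integral => x _; rewrite -/(swap a b x) -dot_swap swap_left.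
- apply/measurable_EFinP; apply: measurable_funM mf.
  exact: measurable_delta_dot.
- by move=> x; rewrite lee_fin mulr_ge0 ?delta_dot_ge0.
Qed.

(** Strict monotonicity and nonnegativity of [h] force [h 1 > 0], so a
    nonpositive [c] would make the density at [theta0] negative or the total
    mass zero. *)
Lemma c_gt0 : 0 < c.
Proof.
have [mf f0 HE] := H_density.
have i1 : (1 : R) \in `[-1, 1] by rewrite in_itv/= lexx; lra.
have iN1 : (-1 : R) \in `[-1, 1] by rewrite in_itv/= lexx; lra.
have h1 : 0 < h 1.
  by apply: (le_lt_trans (h_ge0 iN1)); apply: h_incr => //; lra.
rewrite lt_neqAle; apply/andP; split; last first.
  by have := f0 theta0; rewrite /density /dot dotv_sphere pmulr_lge0.
apply/eqP => c0; have := HE setT measurableT; rewrite [LHS]probability_setT.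
rewrite integral0_eq; last by move=> x _; rewrite /density -c0 mul0r.
by move/eqP; rewrite eqe oner_eq0.
Qed.

Lemma sigma_neq0 : sigma setT <> 0%E.
Proof.
have [mf f0 HE] := H_density.
move=> s0; have := HE setT measurableT; rewrite [LHS]probability_setT.
rewrite null_set_integral//; last exact/measurable_EFinP.
by move/eqP; rewrite eqe oner_eq0.
Qed.

(** When [a . theta0 = b . theta0], the vector [theta0] lies in the mirror of
    [swap a b], so the density is invariant under the swap. *)
Lemma mean_dist_eq a b :
  dot a theta0 = dot b theta0 -> mean_dist a = mean_dist b.
Proof.
move=> ab; rewrite (mean_dist_swap a b) mean_distE; apply: eq_integral => x _.
congr ((_ * (c * h _))%:E); rewrite dot_swap /dot rotateE reflectionE.
by rewrite dotvBl -/(dot a theta0) ab subrr mulr0 mul0r scale0r subr0.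
Qed.

(** The comparison of the opening comment: [g] is the product of the two
    differences, and [key] is the averaged form of
    [2 E(b) = 2 E(a) + int g dsigma], stated without subtraction so that only
    integrals of nonnegative functions occur. *)
Lemma mean_dist_lt a b :
  dot b theta0 < dot a theta0 -> (mean_dist a < mean_dist b)%E.
Proof.
have [mf f0 HE] := H_density.
move=> ab; set w := sphere_val a - sphere_val b.
have wt0 : 0 < dotv w (sphere_val theta0).
  by rewrite dotvBl subr_gt0.
have w0 : w != 0.
  by apply: contraTneq wt0 => ->; rewrite /dotv trmx0 mul0mx mxE ltxx.
have ww : 0 < dotv w w by rewrite lt_neqAle eq_sym dotv_eq0 w0 dotv_ge0.
pose g x :=
  (delta (dot b x) - delta (dot a x)) * (density x - density (swap a b x)).
have reflE x : dot (swap a b x) theta0 =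
    dot x theta0 -
      2 * dotv w (sphere_val x) / dotv w w * dotv w (sphere_val theta0).
  by rewrite /dot rotateE reflectionE -/w dotvBl dotvZl.
have wx x : dotv w (sphere_val x) = dot a x - dot b x by rewrite dotvBl.
have f_lt x y : dot x theta0 < dot y theta0 -> density x < density y.
  move=> xy; rewrite ltr_pM2l ?c_gt0//.
  by apply: h_incr => //; exact: dotv_sphere_itv.
have d_lt x y z : dot x z < dot y z -> delta (dot y z) < delta (dot x z).
  by move=> xy; apply: delta_decr => //; exact: dotv_sphere_itv.
have g_gt0 x : dotv w (sphere_val x) != 0 -> 0 < g x.
  rewrite neq_lt => /orP[wx0|wx0].
    rewrite /g nmulr_rgt0; rewrite subr_lt0.
      apply: f_lt; rewrite reflE ltrDl oppr_gt0 pmulr_llt0// pmulr_llt0 ?invr_gt0//.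
      by rewrite pmulr_rlt0.
    by apply: d_lt; rewrite -subr_lt0 -wx.
  rewrite /g pmulr_rgt0 subr_gt0.
    by apply: f_lt; rewrite reflE ltrBlDr ltrDl !mulr_gt0 ?invr_gt0.
  by apply: d_lt; rewrite -subr_gt0 -wx.
have g_ge0 x : 0 <= g x.
  have [wx0|/g_gt0/ltW//] := eqVneq (dotv w (sphere_val x)) 0.
  by move: wx0; rewrite wx /g => /subr0_eq ->; rewrite subrr mul0r.
have mfr : measurable_fun setT (fun x => density (swap a b x)).
  exact: (measurableT_comp mf (measurable_rotate _)).
have md y := measurable_delta_dot y.
have mg : measurable_fun setT g.
  by apply: measurable_funM; apply: measurable_funB.
have F0 y k : (forall x, 0 <= k x) ->
    forall x, setT x -> (0 <= (delta (dot y x) * k x)%:E)%E.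
  by move=> k0 x _; rewrite lee_fin mulr_ge0 ?delta_dot_ge0.
have mF y k : measurable_fun setT k ->
    measurable_fun setT (fun x => (delta (dot y x) * k x)%:E).
  by move=> mk; apply/measurable_EFinP/measurable_funM.
have swap_sym : swap b a = swap a b.
  apply: funext => x; apply: sphere_val_inj; rewrite !rotateE !reflectionE.
  rewrite -/w (_ : sphere_val b - sphere_val a = -1 *: w); last first.
    by rewrite scaleN1r opprB.
  rewrite !(dotvZl, dotvZr) scalerA.
  by rewrite !mulN1r opprK !mulrN mulr1 mulNr opprK.
have key : (mean_dist b + mean_dist b =
    (mean_dist a + mean_dist a) + \int[sigma]_x (g x)%:E)%E.
  rewrite {1}(mean_distE b) (mean_dist_swap b a) swap_sym.
  rewrite {1}(mean_distE a) (mean_dist_swap a b).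
  rewrite -!ge0_integralD//; try by [apply: mF|apply: F0|].
  - by apply: eq_integral => x _; rewrite -!EFinD; congr EFin; rewrite /g; ring.
  - by move=> x _; rewrite adde_ge0// lee_fin mulr_ge0// delta_dot_ge0.
  - by apply: emeasurable_funD; apply: mF.
  - by move=> x _; rewrite lee_fin.
  - by apply/measurable_EFinP.
have int_gt0 : (0 < \int[sigma]_x (g x)%:E)%E.
  have ig0 : (0 <= \int[sigma]_x (g x)%:E)%E.
    by apply: integral_ge0 => x _; rewrite lee_fin.
  rewrite lt_neqAle ig0 andbT; apply/eqP => int0.
  apply: sigma_neq0; apply: (surface_area_hyperplane w0).
  have : ae_eq sigma setT (EFin \o g) (cst 0%E).
    apply/ae_eq_integral_abs => //; first exact/measurable_EFinP.
    by rewrite int0; apply: eq_integral => x _; rewrite /= ger0_norm.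
  move=> [N [mN N0 gN]].
  apply: (subset_measure0 _ mN _ N0).
    rewrite (_ : mkset _ =
        (fun x : sphere R n => dotv w (sphere_val x)) @^-1` (~` [set 0])).
      apply: measurable_preimage; first exact: measurable_dotv.
      by apply: measurableC; exact: measurable_set1.
    by apply/seteqP; split => x /= /eqP.
  move=> x /= /g_gt0 gx; apply: gN => /= /(_ I) [gx0].
  by rewrite gx0 ltxx in gx.
move: key int_gt0; rewrite -(fineK (mean_dist_fin a)) -(fineK (mean_dist_fin b)).
case: (integral _ _ _) => [r| |] //; rewrite -?EFinD ?lte_fin.
by move=> [] + r0; lra.
Qed.

End rotationally_symmetric.

Unset Implicit Arguments.

(* The ambient dimension is q = n.+1, so q >= 2 reads 0 < n. *)
Theorem theorem3 (R : realType) (n : nat) (n_gt0 : (0 < n)%N)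
    (d : sphere R n -> sphere R n -> R) (delta : R -> R)
    (d_metric : is_metric d)
    (d_rot : rotation_invariant d)
    (d_delta : forall theta psi : sphere R n,
       d theta psi = delta (dotv (sphere_val theta) (sphere_val psi)))
    (delta_ge0 : {in `[-1, 1], forall u : R, 0 <= delta u})
    (delta_decr : {in `[-1, 1] &, forall u v : R, u < v -> delta v < delta u})
    (theta0 : sphere R n) (h : R -> R) (c : R)
    (h_ge0 : {in `[-1, 1], forall u : R, 0 <= h u})
    (h_incr : {in `[-1, 1] &, forall u v : R, u < v -> h u < h v})
    (H : probability (sphere R n) R)
    (H_density : has_density H
       (fun x => c * h (dotv (sphere_val x) (sphere_val theta0)))) :
  (exists2 g : R -> R,
     {in `[-1, 1] &, forall u v : R, u < v -> g u < g v} &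
     forall theta : sphere R n,
       depth d theta H =
         (g (dotv (sphere_val theta) (sphere_val theta0)))%:E) /\
  (forall theta : sphere R n, theta <> theta0 ->
     (depth d theta H < depth d theta0 H)%E).
Proof.
have mfin a : mean_dist delta H a \is a fin_num.
  exact: mean_dist_fin delta_ge0 delta_decr a.
have depthE x : depth d x H = (dist_sup d - fine (mean_dist delta H x))%:E.
  rewrite EFinB fineK// /depth; congr (_ - _)%E; rewrite unlock.
  by apply: eq_integral => y _; rewrite d_delta.
have lt_mean a b : dot b theta0 < dot a theta0 ->
    fine (mean_dist delta H a) < fine (mean_dist delta H b).
  move=> ab; rewrite -lte_fin !fineK//.
  exact: (mean_dist_lt delta_ge0 delta_decr h_ge0 h_incr H_density).
have eq_mean a b : dot a theta0 = dot b theta0 ->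
    mean_dist delta H a = mean_dist delta H b.
  exact: (mean_dist_eq delta_ge0 delta_decr H_density).
split; last first.
  move=> theta neq; rewrite !depthE lte_fin ltrD2l ltrN2; apply: lt_mean.
  by rewrite /dot dotv_sphere; exact: dotv_sphere_lt1.
(* For [u] outside [-1, 1] there is no such point, and [pt u] is theta0. *)
pose pt u := xget theta0 [set x | dot x theta0 = u].
have ptE u : u \in `[-1, 1] -> dot (pt u) theta0 = u.
  move=> u1; have [x xu] := exists_dotv_sphere theta0 n_gt0 u1.
  exact: (@xgetPex _ theta0 [set x | dot x theta0 = u]) (ex_intro _ x xu).
exists (fun u => dist_sup d - fine (mean_dist delta H (pt u))).
  by move=> u v u1 v1 uv; rewrite ltrD2l ltrN2; apply: lt_mean; rewrite !ptE.
move=> theta; rewrite depthE; congr ((_ - fine _)%:E); apply: eq_mean.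
by rewrite ptE//; exact: dotv_sphere_itv.
Qed.
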